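(* For every discrete martingale-difference sequence $d=\{d_1,\dots,d_n\}$ (any $n\ge1$, with $0<\|\mathfrak S(d)\|_\infty<\infty$) and every number $0<\lambda<1/2$, $$\mathbf E\left[\exp\left(\lambda\cdot\left(\frac{\sum_{k=1}^n d_k}{\|\mathfrak S(d)\|_\infty}\right)^2\right)\right]\le\frac{1}{\sqrt{1-2\lambda}},$$ where for each $\lambda$ the constant on the right-hand side is the best possible (as $n$ and $d$ vary). Moreover, it remains the best constant if in this inequality one considers only dyadic martingales, or only Rademacher martingales.
   Context: All random variables are real-valued. Let $(X,\mathscr F,\mu)$ be a probability space. A discrete filtration is an increasing sequence of $\sigma$-algebras $\mathscr F_0\subset\mathscr F_1\subset\dots\subset\mathscr F$ such that each $\mathscr F_k$ is generated by a finite or countable partition $\mathscr D_k$ of $X$ into disjoint measurable sets of positive measure, where $\mathscr D_0=\{X\}$ and every set in $\mathscr D_k$ is a union of elements of $\mathscr D_{k+1}$ (its children being the elements of $\mathscr D_{k+1}$ it contains). A discrete martingale-difference sequence $d=\{d_1,\dots,d_n\}$ with respect to such a filtration is a sequence of integrable random variables with $d_k$ being $\mathscr F_k$-measurable and $\int_V d_k\,d\mu=0$ for every $V\in\mathscr D_{k-1}$, $k=1,\dots,n$. Its square function is $$\mathfrak S(d)(x)=\Big(\sum_{k=1}^n |D_k(x)|^2\Big)^{1/2},\qquad D_k(x)=\sum_{V\in\mathscr D_{k-1}}\|\mathbf 1_V d_k\|_\infty\,\mathbf 1_V(x).$$ The martingale is dyadic if every $V\in\mathscr D_{k-1}$ has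 exactly two children $V^+,V^-\in\mathscr D_k$ and $\mu(V^+)=\mu(V^-)=\mu(V)/2$. A Rademacher martingale is the case $X=[0,1)$ with Lebesgue measure, $\mathscr D_k$ the dyadic intervals $[(j-1)/2^k,j/2^k)$, $1\le j\le 2^k$, and $d_k=a_kr_k$ with real $a_k$ and $r_k(x)=\operatorname{sign}\sin(2^k\pi x)$, $k\ge 1$. *)

(* Defs.v *)
From HB Require Import structures.
From mathcomp Require Import all_boot all_order all_algebra.
From mathcomp Require Import all_classical all_reals all_analysis.

Set Implicit Arguments.
Unset Strict Implicit.
Unset Printing Implicit Defensive.

Import Order.TTheory GRing.Theory Num.Theory.
Import numFieldNormedType.Exports.

Local Open Scope classical_set_scope.
Local Open Scope ring_scope.

(* [D k] is the partition $\mathscr D_k$; the $\sigma$-algebra $\mathscr F_k$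
   is [<<s D k>>], carried by the type [g_sigma_algebraType (D k)]. *)
Record discrete_filtration (R : realType) (d : measure_display)
    (T : measurableType d) (P : probability T R) (D : nat -> set (set T)) :
    Prop := {
  dfilt_countable : forall k, countable (D k);
  dfilt_partition : forall k, partition (D k) id [set: T];
  dfilt_measurable : forall k V, D k V -> measurable V;
  dfilt_pos : forall k V, D k V -> (0 < P V)%E;
  dfilt_start : D 0%N = [set [set: T]];
  dfilt_refine : forall k V, D k V ->
    exists2 S, S `<=` D k.+1 & V = \bigcup_(U in S) U }.

Lemma discrete_filtration_sub (R : realType) (d : measure_display)
    (T : measurableType d) (P : probability T R) (D : nat -> set (set T)) k :
  discrete_filtration P D -> <<s D k>> `<=` <<s D k.+1>>.
Proof.
move=> DF; apply: smallest_sub; first exact: smallest_sigma_algebra.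
move=> V DV; have [S SD ->] := dfilt_refine DF DV.
rewrite bigcup_set_type.
apply: (@countable_bigcupT_measurable _ (g_sigma_algebraType (D k.+1))).
  rewrite (eq_countable (card_setT S)).
  exact: sub_countable (subset_card_le SD) (dfilt_countable DF k.+1).
by move=> U; apply: sub_sigma_algebra; apply: SD; exact: set_valP.
Qed.

Definition children (T : Type) (D : nat -> set (set T)) (k : nat) (V : set T) :
  set (set T) := [set U | D k.+1 U /\ U `<=` V].

(* Only the values [f 1], ..., [f n] of the sequence are relevant. *)
Record martingale_difference (R : realType) (d : measure_display)
    (T : measurableType d) (P : probability T R) (D : nat -> set (set T))
    (n : nat) (f : nat -> T -> R) : Prop := {
  mdiff_filtration : discrete_filtration P D;
  mdiff_integrable : forall k, (1 <= k <= n)%N ->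
    P.-integrable [set: T] (EFin \o f k);
  mdiff_adapted : forall k, (1 <= k <= n)%N ->
    @measurable_fun _ _ (g_sigma_algebraType (D k)) R [set: T] (f k);
  mdiff_mean0 : forall k V, (1 <= k <= n)%N -> D k.-1 V ->
    (\int[P]_(x in V) (f k x)%:E = 0)%E }.

(* The function $D_k$. It may take the value [+oo]. *)
Definition block_sup (R : realType) (d : measure_display)
    (T : measurableType d) (P : probability T R) (D : nat -> set (set T))
    (f : nat -> T -> R) (k : nat) (x : T) : \bar R :=
  (\esum_(V in D k.-1)
     ('N[P]_+oo[EFin \o (\1_V \* f k)%R] * (\1_V x)%:E))%E.

Definition square_function (R : realType) (d : measure_display)
    (T : measurableType d) (P : probability T R) (D : nat -> set (set T))
    (n : nat) (f : nat -> T -> R) (x : T) : \bar R :=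
  ((\sum_(1 <= k < n.+1) `|block_sup P D f k x| ^+ 2) `^ (2^-1)%R)%E.

Definition square_norm (R : realType) (d : measure_display)
    (T : measurableType d) (P : probability T R) (D : nat -> set (set T))
    (n : nat) (f : nat -> T -> R) : \bar R :=
  'N[P]_+oo[square_function P D n f]%E.

Definition exp_square_moment (R : realType) (d : measure_display)
    (T : measurableType d) (P : probability T R) (D : nat -> set (set T))
    (n : nat) (f : nat -> T -> R) (lambda : R) : \bar R :=
  'E_P[(fun x => expR (lambda *
    ((\sum_(1 <= k < n.+1) f k x) / fine (square_norm P D n f)) ^+ 2))]%E.

Record admissible (R : realType) (d : measure_display)
    (T : measurableType d) (P : probability T R) (D : nat -> set (set T))
    (n : nat) (f : nat -> T -> R) : Prop := {
  admissible_size : (1 <= n)%N;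
  admissible_mdiff : martingale_difference P D n f;
  admissible_norm : (0 < square_norm P D n f < +oo)%E }.

(* [V] ranges over the elements of $\mathscr D_{k-1}$ for $1\le k\le n$,
   written here with [k] in place of $k-1$. *)
Definition dyadic (R : realType) (d : measure_display)
    (T : measurableType d) (P : probability T R) (D : nat -> set (set T))
    (n : nat) : Prop :=
  forall k V, (k < n)%N -> D k V ->
    exists V1 V2 : set T, [/\ V1 <> V2, children D k V = [set V1; V2],
      P V1 = (P V * 2^-1%:E)%E & P V2 = (P V * 2^-1%:E)%E].

(* The probability space $[0,1)$, with the trace of the Borel $\sigma$-algebra
   and the restriction of Lebesgue measure. *)
Definition unit_interval (R : realType) : Type := {x : R | 0 <= x < 1}.

Definition unit_interval_val (R : realType) (x : unit_interval R) :
  measurableTypeR R := val x.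

Fact unit_interval0 (R : realType) : 0 <= (0 : R) < 1.
Proof. by rewrite lexx ltr01. Qed.

HB.instance Definition _ (R : realType) := Choice.on (unit_interval R).
HB.instance Definition _ (R : realType) :=
  isPointed.Build (unit_interval R) (exist _ 0 (unit_interval0 R)).
HB.instance Definition _ (R : realType) := Measurable.copy (unit_interval R)
  (g_sigma_algebra_preimageType (@unit_interval_val R)).

Definition unit_lebesgue (R : realType) (A : set (unit_interval R)) : \bar R :=
  lebesgue_measure (@unit_interval_val R @` A).

Lemma unit_interval_val_inj (R : realType) : injective (@unit_interval_val R).
Proof. exact: val_inj. Qed.

Lemma unit_interval_val_range (R : realType) :
  range (@unit_interval_val R) = `[0, 1[%classic.
Proof.
apply/seteqP; split => [_ [[x x01] _ <-]|x] /=.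
  by rewrite in_itv.
by rewrite in_itv /= => x01; exists (exist _ x x01).
Qed.

Lemma measurable_unit_interval_val (R : realType) (A : set (unit_interval R)) :
  measurable A -> measurable (@unit_interval_val R @` A).
Proof.
move=> [B mB <-]; rewrite setTI.
suff -> : @unit_interval_val R @` (@unit_interval_val R @^-1` B) =
    B `&` `[0, 1[%classic by apply: measurableI => //; exact: measurable_itv.
rewrite -unit_interval_val_range.
apply/seteqP; split => y; first by move=> [x Bx <-]; split => //; exists x.
by move=> [By [x _ xy]]; exists x => //=; rewrite xy.
Qed.

Section unit_lebesgue_probability.
Context (R : realType).

Let unit_lebesgue0 : @unit_lebesgue R set0 = 0%E.
Proof. by rewrite /unit_lebesgue image_set0 measure0. Qed.

Let unit_lebesgue_ge0 (A : set (unit_interval R)) : (0 <= unit_lebesgue A)%E.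
Proof. exact: measure_ge0. Qed.

Let unit_lebesgue_sigma_additive : semi_sigma_additive (@unit_lebesgue R).
Proof.
move=> F mF tF mUF; rewrite /unit_lebesgue image_bigcup.
apply: measure_semi_sigma_additive.
- by move=> i; exact: measurable_unit_interval_val.
- move=> i j _ _ [_ [[x Fix <-] [y Fjy /unit_interval_val_inj yx]]].
  by apply: tF => //; exists x; split => //; rewrite -yx.
- by rewrite -image_bigcup; exact: measurable_unit_interval_val.
Qed.

HB.instance Definition _ := isMeasure.Build _ (unit_interval R) R
  (@unit_lebesgue R) unit_lebesgue0 unit_lebesgue_ge0
  unit_lebesgue_sigma_additive.

Let unit_lebesgue_setT : @unit_lebesgue R [set: _] = 1%E.
Proof.
rewrite /unit_lebesgue unit_interval_val_range lebesgue_measure_itv /=.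
by rewrite lte_fin ltr01 sube0.
Qed.

HB.instance Definition _ := Measure_isProbability.Build _ (unit_interval R) R
  (@unit_lebesgue R) unit_lebesgue_setT.

End unit_lebesgue_probability.

Definition dyadic_intervals (R : realType) (k : nat) :
    set (set (unit_interval R)) :=
  [set [set x | (j%:R - 1) / 2 ^+ k <= unit_interval_val x < j%:R / 2 ^+ k]
    | j in [set j | (1 <= j <= 2 ^ k)%N]].

Definition rademacher (R : realType) (k : nat) (x : unit_interval R) : R :=
  Num.sg (sin (2 ^+ k * pi * unit_interval_val x)).

(* The equality is between random variables, i.e. almost sure: as
   [Num.sg 0 = 0], [rademacher k] vanishes at the dyadic points [j / 2 ^ k], so
   it is constant on each interval of generation [k] only up to a null set. *)
Definition rademacher_sequence (R : realType) (n : nat)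
    (f : nat -> unit_interval R -> R) : Prop :=
  exists a : nat -> R, forall k, (1 <= k <= n)%N ->
    {ae @unit_lebesgue R, forall x, f k x = a k * rademacher k x}.

(* Main.v *)
(** The function [B(x, s) = E exp (lambda (x + sqrt s g)^2)], [g] standard
    Gaussian, has the closed form [exp (lambda x^2 / t) / sqrt t] with
    [t = 1 - 2 lambda s], and [E B(x + y, s) <= B(x, s + c^2)] whenever [y] has
    mean zero and [|y| <= c]. Hence, after normalizing the norm of the square
    function to 1, [B(S_k, 1 - sum_(j <= k) D_j^2)] has decreasing expectations,
    from [B(0, 1) = 1 / sqrt (1 - 2 lambda)] at [k = 0] down to at least
    [E exp (lambda S_n^2)] at [k = n].

    For the sharpness, let [S_n] be the sum of [n] Rademacher functions. The even
    moments satisfy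
    [E S_(n+1)^(2m+2) >= E S_n^(2m+2) + (m+1)(2m+1) E S_n^(2m)], so
    [E S_n^(2m) >= (2m-1)!! n(n-1)...(n-m+1)], which is [n^m] times the Gaussian
    moment as [n] tends to infinity. Expanding the exponential then gives the
    bound [sum_m lambda^m (2m-1)!! / m!], whose square is the geometric series
    of ratio [2 lambda]. *)
Require Import Defs.
From mathcomp Require Import all_boot all_order all_algebra.
From mathcomp Require Import all_classical all_reals all_analysis.
From mathcomp Require Import measurable_realfun ess_sup_inf.
From mathcomp Require Import ring lra zify.

Import Order.TTheory GRing.Theory Num.Theory.
Import numFieldNormedType.Exports.

Local Open Scope classical_set_scope.
Local Open Scope ring_scope.

(** * The Bellman function *)

(** This compares the Taylor coefficients of [cosh z] with those of [exp (z^2 / 2)]: passing from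
    [n] to [n.+1] multiplies the left side by [2 * n.+1] and the right side by at least that. *)
Lemma leq_expn2_fact n : (2 ^ n * n`! <= (2 * n)`!)%N.
Proof.
elim: n => // n IHn; rewrite mulnS !factS expnS.
have -> : (2 * 2 ^ n * (n.+1 * n`!) = (2 * n.+1) * (2 ^ n * n`!))%N by lia.
rewrite [leqRHS]mulnA; apply: leq_mul => //; lia.
Qed.

Lemma expR_addN_le {R : realType} (z : R) :
  expR z + expR (- z) <= 2 * expR (z ^+ 2 / 2).
Proof.
pose u x n : R := series (exp_coeff x) n.
have u_cvg x : u x n @[n --> \oo] --> expR x := is_cvg_series_exp_coeff x.
have u2_cvg x : u x (2 * n)%N @[n --> \oo] --> expR x.
  by apply: cvg_comp (u_cvg x); exact: cvg_mulnl.
have uS x n : u x n.+1 = u x n + x ^+ n / n`!%:R by rewrite /u seriesSr.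
have u0 x : u x 0%N = 0 by rewrite /u /series /= big_geq.
(* The odd-degree terms of the two series cancel, so [2 * n] terms on the left are matched with [n]
   terms on the right, degree by degree. *)
have u_le n : u z (2 * n)%N + u (- z) (2 * n)%N <= 2 * u (z ^+ 2 / 2) n.
  elim: n => [|n IHn]; first by rewrite muln0 !u0 addr0 mulr0.
  rewrite mulnS !add2n !uS mulrDr.
  have -> : (- z) ^+ (2 * n) = z ^+ (2 * n) by rewrite exprM sqrrN -exprM.
  have -> : (- z) ^+ (2 * n).+1 = - z ^+ (2 * n).+1.
    by rewrite !exprS exprM sqrrN -exprM mulNr.
  suff : z ^+ (2 * n) / (2 * n)`!%:R <= (z ^+ 2 / 2) ^+ n / n`!%:R by lra.
  rewrite expr_div_n exprM -mulrA; apply: ler_wpM2l; first by rewrite exprn_ge0 // sqr_ge0.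
  rewrite -invfM lef_pV2 ?posrE ?mulr_gt0 ?exprn_gt0 ?ltr0n ?fact_gt0 //.
  by rewrite -natrX -natrM ler_nat leq_expn2_fact.
apply: (@ler_cvg_to nat \oo _ R (fun n => u z (2 * n)%N + u (- z) (2 * n)%N)
  (fun n => 2 * u (z ^+ 2 / 2) n)).
- exact: cvgD.
- by apply: cvgM => //; exact: cvg_cst.
- by apply: nearW => n; exact: u_le.
Qed.

(** Convexity of the exponential: [z * w] is the combination of [z] and [- z] with weights
    [(1 + w) / 2] and [(1 - w) / 2]. *)
Lemma expR_conv_le {R : realType} (z w : R) : `|w| <= 1 ->
  2 * expR (z * w) <= (1 + w) * expR z + (1 - w) * expR (- z).
Proof.
rewrite ler_norml => /andP[wl wu].
have t0 : 0 <= (1 + w) / 2 by lra.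
have t1 : (1 + w) / 2 <= 1 by lra.
have := convex_expR (Itv01 t0 t1) z (- z); rewrite !convRE /= /unstable.onem.
have -> : (1 + w) / 2 * z + (1 - (1 + w) / 2) * - z = z * w by lra.
lra.
Qed.

(* [B(x, s)] in terms of [t = 1 - 2 lambda s]. *)
Definition bellman {R : realType} (lambda x t : R) : R :=
  expR (lambda * x ^+ 2 / t) / Num.sqrt t.

Section bellman.
Context {R : realType} (lambda : R).
Hypothesis lambda_gt0 : 0 < lambda.

(** A pointwise form of the concavity property of the Bellman function: the affine majorant has
    value [bellman lambda x t] at [y = 0], and its linear term vanishes on integrating a mean-zero
    [y]. *)
Lemma bellman_chord (x t c : R) : 0 < t -> 0 <= c ->
  exists b : R, forall y, `|y| <= c ->
    bellman lambda (x + y) (t + 2 * lambda * c ^+ 2) <= bellman lambda x t + b * y.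
Proof.
move=> t0; rewrite le_eqVlt => /predU1P[<-|c0].
  exists 0 => y; rewrite normr_le0 => /eqP ->.
  by rewrite expr0n /= !(mulr0, addr0).
set t' := t + _.
have tt' : t < t' by rewrite ltrDl !mulr_gt0 ?exprn_gt0.
have t'0 : 0 < t' := lt_trans t0 tt'.
pose l := lambda / t'; pose u := l * c ^+ 2; pose z := 2 * l * x * c.
have l0 : 0 < l by exact: divr_gt0.
have u0 : 0 < u by rewrite mulr_gt0 // exprn_gt0.
(* Factoring [t] through [t'] turns the hypothesis [0 < t] into [2 * u < 1], and everything below is
   expressed in [l], [u] and [z]. *)
have tE : t = t' * (1 - 2 * u).
  by rewrite /u /l mulrBr; have -> : t' * (2 * (lambda / t' * c ^+ 2)) = 2 * lambda * c ^+ 2;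
    [field; rewrite gt_eqF | rewrite /t'; lra].
have u1 : 0 < 1 - 2 * u by rewrite -(pmulr_rgt0 _ t'0) -tE.
pose K := expR (l * (x ^+ 2 + c ^+ 2)) / Num.sqrt t'.
have K0 : 0 <= K by rewrite divr_ge0 ?expR_ge0 ?sqrtr_ge0.
(* The slope of the chord over [[-c, c]] of the convex function [y |-> K * expR (z * y / c)]. *)
exists (K * (expR z - expR (- z)) / (2 * c)) => y yc.
have yc2 : y ^+ 2 <= c ^+ 2 by rewrite -(real_normK (num_real y)) lerXn2r ?nnegrE // ltW.
(* [(x + y)^2 <= x^2 + c^2 + 2 x y] on [|y| <= c], and the exponential of the
   remaining linear term lies below its chord. *)
have chord : bellman lambda (x + y) t' <=
    K * ((1 + y / c) * expR z + (1 - y / c) * expR (- z)) / 2.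
  have := @expR_conv_le R z (y / c).
  rewrite normrM normfV (gtr0_norm c0) ler_pdivrMr // mul1r => /(_ yc).
  have -> : z * (y / c) = 2 * l * x * y by rewrite /z; field; rewrite gt_eqF.
  move=> /(ler_wpM2l K0).
  suff : bellman lambda (x + y) t' <= K * expR (2 * l * x * y) by lra.
  rewrite /bellman /K [leRHS]mulrAC -expRD.
  apply: ler_wpM2r; first by rewrite invr_ge0 sqrtr_ge0.
  by rewrite ler_expR mulrAC -/l; nra.
(* The value of the chord at [y = 0] is [K * cosh z], which is bounded through
   [cosh z <= expR (z ^+ 2 / 2)]; the change of square root from [t'] to [t] is absorbed by
   [1 - 2 * u <= expR (- 2 * u)]. *)
have center : K * (expR z + expR (- z)) / 2 <= bellman lambda x t.
  apply: (@le_trans _ _ (K * expR (z ^+ 2 / 2))).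
    by have := ler_wpM2l K0 (expR_addN_le z); lra.
  rewrite /bellman tE sqrtrM ?(ltW t'0) //.
  have sqrt_u : Num.sqrt (1 - 2 * u) <= expR (- u).
    rewrite -(ler_pXn2r (ltn0Sn 1)) ?nnegrE ?sqrtr_ge0 ?expR_ge0 // sqr_sqrtr ?(ltW u1) //.
    by rewrite -expRM_natl; have := expR_ge1Dx (2 * - u); lra.
  have s0 : 0 < Num.sqrt t' by rewrite sqrtr_gt0.
  rewrite ler_pdivlMr; last by rewrite mulr_gt0 ?sqrtr_gt0.
  have -> : K * expR (z ^+ 2 / 2) * (Num.sqrt t' * Num.sqrt (1 - 2 * u)) =
    expR (l * (x ^+ 2 + c ^+ 2) + z ^+ 2 / 2) * Num.sqrt (1 - 2 * u).
    by rewrite expRD /K; field; rewrite gt_eqF.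
  apply: (@le_trans _ _ (expR (l * (x ^+ 2 + c ^+ 2) + z ^+ 2 / 2) * expR (- u))).
    by rewrite ler_wpM2l ?expR_ge0.
  rewrite -expRD ler_expR.
  have -> : lambda * x ^+ 2 / (t' * (1 - 2 * u)) = l * x ^+ 2 / (1 - 2 * u).
    by rewrite /l; field; rewrite !gt_eqF.
  rewrite ler_pdivlMr //.
  (* The terms free of [x] cancel, and what remains to be shown is [(1 + 2 * u) * (1 - 2 * u) <= 1],
     up to the factor [l * x ^+ 2]. *)
  have -> : l * (x ^+ 2 + c ^+ 2) + z ^+ 2 / 2 - u = l * x ^+ 2 * (1 + 2 * u).
    by rewrite /z /u; field.
  have lx0 : 0 <= l * x ^+ 2 by rewrite mulr_ge0 ?sqr_ge0 // ltW.
  by nra.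
have : K * (expR z - expR (- z)) / (2 * c) * y = K * (expR z - expR (- z)) * (y / c) / 2.
  by field; rewrite gt_eqF.
by lra.
Qed.

End bellman.

(** * Functions constant on the blocks of a partition *)

(** The pointwise substitute for measurability with respect to the $\sigma$-algebra generated by the
    partition [D]. *)
Definition constant_on_blocks {T U : Type} (D : set (set T)) (g : T -> U) : Prop :=
  forall V x y, D V -> V x -> V y -> g x = g y.

(** Countable additivity needs a sequence: the blocks are numbered by an injection [h], and every
    index outside its range receives the empty set. *)
Lemma partition_enum {T : pointedType} (D : set (set T)) :
    countable D -> partition D id [set: T] ->
  exists F : nat -> set T,
    [/\ forall n, F n = set0 \/ D (F n), trivIset [set: nat] F &
        \bigcup_n F n = [set: T]].
Proof.
move=> /countable_injP[h h_inj] [DT tD _].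
pose F n := \bigcup_(V in [set V | D V /\ h V = n]) V.
have FE V : D V -> F (h V) = V.
  move=> DV; apply/seteqP; split => [x [W [DW hWV] Wx]|x Vx]; last by exists V.
  by rewrite -(h_inj _ _ (mem_set DW) (mem_set DV) hWV).
exists F; split.
- move=> n; have [[V [DV <-]]|nV] := pselect (exists V, D V /\ h V = n).
    by right; rewrite FE.
  by left; apply/seteqP; split => // x [V DV _]; apply: nV; exists V.
- move=> m n _ _ [x [[V [DV <-] Vx] [W [DW <-] Wx]]].
  by congr h; apply: tD => //; exists x.
- apply/seteqP; split => // x _.
  have : cover D id x by rewrite DT.
  by case=> V DV Vx; exists (h V) => //; rewrite FE.
Qed.

Section measurable_partition.
Context {d : measure_display} {T : measurableType d} (D : set (set T)).
Hypotheses (countD : countable D) (partD : partition D id [set: T])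
  (mD : forall V, D V -> measurable V).

(** A preimage meets each block either in the whole block or not at all, hence is a countable union
    of blocks. *)
Lemma measurable_fun_blocks {d'} {U : measurableType d'} (g : T -> U) :
  constant_on_blocks D g -> measurable_fun [set: T] g.
Proof.
move=> gD _ B _; have [F [FD _ FT]] := partition_enum D countD partD.
rewrite setTI; have -> : g @^-1` B = \bigcup_n (F n `&` g @^-1` B).
  by rewrite -setI_bigcupl FT setTI.
apply: bigcupT_measurable => n.
have [-> | DF] := FD n; first by rewrite set0I.
have [[x [Fx Bx]]|nB] := pselect (F n `&` g @^-1` B !=set0).
  suff -> : F n `&` g @^-1` B = F n by exact: mD.
  by apply/setIidPl => y Fy; rewrite /= -(gD _ _ _ DF Fx Fy).
suff -> : F n `&` g @^-1` B = set0 by [].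
by apply/seteqP; split => // x Fx; case: nB; exists x.
Qed.

Lemma le_integral_blocks {R : realType} (mu : {measure set T -> \bar R})
    (f g : T -> \bar R) :
    measurable_fun [set: T] f -> measurable_fun [set: T] g ->
    (forall x, 0 <= f x)%E -> (forall x, 0 <= g x)%E ->
    (forall V, D V -> \int[mu]_(x in V) f x <= \int[mu]_(x in V) g x)%E ->
  (\int[mu]_x f x <= \int[mu]_x g x)%E.
Proof.
move=> mf mg f0 g0 fg; have [F [FD tF FT]] := partition_enum D countD partD.
have mF n : measurable (F n) by have [->|/mD] := FD n.
rewrite -FT !ge0_integral_bigcup ?FT //; apply: lee_nneseries => n.
  by move=> _ _; exact: integral_ge0.
by move=> _; have [->|/fg //] := FD n; rewrite !integral_set0.
Qed.

End measurable_partition.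

(** The sets that never separate two points of one block form a $\sigma$-algebra containing [D]; the
    preimage of the singleton [[set g x]] is therefore such a set. *)
Lemma measurable_generated_blocks {T : pointedType} {R : realType}
    (D : set (set T)) (g : T -> R) :
    trivIset D id -> @measurable_fun _ _ (g_sigma_algebraType D) R [set: T] g ->
  constant_on_blocks D g.
Proof.
move=> tD mg V x y DV Vx Vy.
pose P (A : set T) := forall V x y, D V -> V x -> V y -> A x -> A y.
have PD : <<s D >> `<=` P.
  apply: smallest_sub; first split.
  - by [].
  - by move=> A PA W z t DW Wz Wt [_ nAz]; split => // /(PA _ _ _ DW Wt Wz).
  - by move=> F PF W z t DW Wz Wt [n _ Fz]; exists n => //; exact: (PF n W z t).
  - move=> U DU W z t DW Wz Wt Uz.
    by have -> : U = W by apply: tD => //; exists z.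
have : measurable [set g x] by [].
move=> /(mg measurableT); rewrite setTI => /PD /(_ V x y DV Vx Vy erefl).
by move=> /= ->.
Qed.

(** Since blocks have positive measure, this turns almost sure bounds into bounds at some point of a
    block, and so at every point when the quantities are constant there. *)
Lemma ae_exists {d : measure_display} {T : measurableType d} {R : realType}
    (mu : {measure set T -> \bar R}) (V : set T) (Q : T -> Prop) :
    measurable V -> (0 < mu V)%E -> {ae mu, forall x, Q x} ->
  exists2 x, V x & Q x.
Proof.
move=> mV V0 [N [mN N0 QN]]; apply: contrapT => nVQ.
suff VN : V `<=` N.
  move: V0; apply/negP; rewrite -leNgt -N0.
  by apply: le_measure; rewrite ?inE.
by move=> x Vx; apply: QN => Qx; apply: nVQ; exists x.
Qed.

(** One step of the martingale on one block: the affine majorant of [bellman_chord] is integrated,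
    and its linear part has integral zero. *)
Lemma integral_bellman_le {d : measure_display} {T : measurableType d}
    {R : realType} (mu : {finite_measure set T -> \bar R}) (V : set T)
    (g : T -> R) (lambda s t c : R) :
    0 < lambda -> 0 < t -> 0 <= c -> measurable V ->
    measurable_fun V (fun x => bellman lambda (s + g x) (t + 2 * lambda * c ^+ 2)) ->
    mu.-integrable V (EFin \o g) -> (\int[mu]_(x in V) (g x)%:E = 0)%E ->
    {ae mu, forall x, V x -> `|g x| <= c} ->
  (\int[mu]_(x in V) (bellman lambda (s + g x) (t + 2 * lambda * c ^+ 2))%:E
    <= (bellman lambda s t)%:E * mu V)%E.
Proof.
move=> l0 t0 c0 mV mB ig g0 gc.
have [b chord] := bellman_chord lambda l0 s t c t0 c0.
have ige : mu.-integrable V (fun x => b%:E * (g x)%:E)%E by exact: integrableZl.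
have ic : mu.-integrable V (cst (bellman lambda s t)%:E) by apply: finite_measure_integrable_cst.
have iG := integrableD mV ic ige.
have mG := measurable_int _ iG.
have bellman_ge0 x u : 0 <= bellman lambda x u :> R.
  by rewrite divr_ge0 ?expR_ge0 ?sqrtr_ge0.
(* The affine majorant is known to be nonnegative only where [|g x| <= c], that is almost
   everywhere. Its absolute value is nonnegative everywhere, as monotonicity of the integral
   requires, and is removed afterwards by almost sure equality. *)
apply: (@le_trans _ _ (\int[mu]_(x in V) `|(bellman lambda s t)%:E + b%:E * (g x)%:E|)%E).
  apply: ae_ge0_le_integral => //.
  - by move=> x _; rewrite lee_fin.
  - by apply/measurable_EFinP.
  - exact: measurableT_comp.
  apply: filterS gc => x gxc /gxc/chord; rewrite -EFinM -EFinD /= !lee_fin => h.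
  by rewrite (le_trans h) // ler_norm.
rewrite (ae_eq_integral (fun x => (bellman lambda s t)%:E + b%:E * (g x)%:E)%E) //; last 2 first.
- exact: measurableT_comp.
- apply: filterS gc => x gxc /gxc/chord h; rewrite gee0_abs //.
  by rewrite -EFinM -EFinD lee_fin (le_trans _ h).
rewrite integralD // integralZl // g0 mule0 adde0.
by rewrite integral_cst.
Qed.

Lemma Lnormy_ess_sup {d : measure_display} {T : measurableType d} {R : realType}
    (P : probability T R) (f : T -> \bar R) :
  'N[P]_+oo[f]%E = ess_sup P (abse \o f).
Proof.
have P1 : (0 < P [set: T])%E by rewrite probability_setT lte01.
by rewrite unlock; case: ifPn => //; rewrite P1.
Qed.

(** * Block suprema and the square function along a filtration *)

Section filtration.
Context {R : realType} {d : measure_display} {T : measurableType d}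
  {P : probability T R} {D : nat -> set (set T)}.
Hypothesis DF : discrete_filtration P D.

(** The block [V] of generation [k] through a point of [U] is a union of blocks of generation
    [k.+1]; the one through that point can only be [U]. *)
Lemma filtration_refine k U : D k.+1 U -> exists2 V, D k V & U `<=` V.
Proof.
move=> DU; have [_ tD ne] := dfilt_partition DF k.+1.
have [x Ux] := ne _ DU; have [DT _ _] := dfilt_partition DF k.
have : cover (D k) id x by rewrite DT.
case=> V DV Vx; exists V => //.
have [S SD VE] := dfilt_refine DF DV.
move: Vx; rewrite VE => -[W SW Wx]; have -> : U = W.
  by apply: tD => //; [exact: SD | exists x].
exact: bigcup_sup.
Qed.

Lemma constant_on_blocks_refine {U : Type} j k (g : T -> U) :
  (j <= k)%N -> constant_on_blocks (D j) g -> constant_on_blocks (D k) g.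
Proof.
move=> /subnK <- gj; elim: (k - j)%N => // i IHi W x y DW Wx Wy.
have [V DV WV] := filtration_refine _ _ DW.
by apply: IHi DV _ _; exact: WV.
Qed.

Lemma block_of k x : exists2 V, D k V & V x.
Proof.
have [DT _ _] := dfilt_partition DF k.
by have : cover (D k) id x by rewrite DT.
Qed.

(** By disjointness, every term of the sum other than that of the block containing [x] has indicator
    zero. *)
Lemma block_supE (f : nat -> T -> R) k V x : D k.-1 V -> V x ->
  block_sup P D f k x = ('N[P]_+oo[EFin \o (\1_V \* f k)%R])%E.
Proof.
move=> DV Vx; have [_ tD _] := dfilt_partition DF k.-1; rewrite /block_sup.
transitivity (\esum_(W in D k.-1 `&` [set V])
   ('N[P]_+oo[EFin \o (\1_W \* f k)%R] * (\1_W x)%:E))%E.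
  rewrite esum_mkcondr; apply: eq_esum => W DW.
  case: ifPn => //; rewrite indicE => /negP WV.
  rewrite memNset ?mule0 // => Wx; apply: WV; rewrite inE /=.
  by apply: tD => //; exists x.
have -> : D k.-1 `&` [set V] = [set V] by apply/setIidPr => _ ->.
rewrite esum_set1 indicE mem_set ?mule1 //; exact: Lnorm_ge0.
Qed.

Lemma constant_on_blocks_block_sup (f : nat -> T -> R) k :
  constant_on_blocks (D k.-1) (block_sup P D f k).
Proof. by move=> V x y DV Vx Vy; rewrite !(block_supE f k V). Qed.

Lemma block_sup_ge0 (f : nat -> T -> R) k x : (0 <= block_sup P D f k x)%E.
Proof.
have [V DV Vx] := block_of k.-1 x.
by rewrite (block_supE f k V) //; exact: Lnorm_ge0.
Qed.

Lemma le_block_sup (f : nat -> T -> R) k V x : D k.-1 V -> V x ->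
  {ae P, forall y, V y -> (`|f k y|%:E <= block_sup P D f k x)%E}.
Proof.
move=> DV Vx; rewrite (block_supE f k V) // Lnormy_ess_sup.
have := ess_sup_ge P (abse \o (EFin \o (\1_V \* f k))).
apply: filterS => y /[swap] Vy; apply: le_trans.
by rewrite /= indicE mem_set // mul1r.
Qed.

(** The bound holds at every point, not just almost everywhere: the square function is constant on
    the blocks of generation [n], all of positive measure. *)
Lemma square_function_le_norm (f : nat -> T -> R) n x :
  (square_function P D n f x <= square_norm P D n f)%E.
Proof.
have sqc : constant_on_blocks (D n) (square_function P D n f).
  move=> V y z DV Vy Vz; rewrite /square_function; congr poweR.
  apply: eq_big_nat => k /andP[k1 kn]; congr ((`| _ | ^+ 2)%E).
  apply: (constant_on_blocks_refine k.-1 n) DV Vy Vz; last exact: constant_on_blocks_block_sup.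
  by rewrite (leq_trans (leq_pred k)).
have [V DV Vx] := block_of n x.
have := ess_sup_ge P (abse \o square_function P D n f).
move=> /(ae_exists P V _ (dfilt_measurable DF DV) (dfilt_pos DF DV)) [y Vy].
rewrite /square_norm Lnormy_ess_sup; apply: le_trans.
by rewrite /= (sqc _ _ _ DV Vx Vy) lee_abs.
Qed.

End filtration.

Section square_norm.
Context {R : realType} {d : measure_display} {T : measurableType d}
  {P : probability T R} {D : nat -> set (set T)}.
Hypothesis DF : discrete_filtration P D.
Context {n : nat} {f : nat -> T -> R}.
Hypothesis norm_lty : (square_norm P D n f < +oo)%E.

Let sum_lty x : (\sum_(1 <= k < n.+1) `|block_sup P D f k x| ^+ 2 < +oo)%E.
Proof.
have := le_lt_trans (square_function_le_norm DF f n x) norm_lty.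
by apply: lty_poweRy; rewrite invr_neq0.
Qed.

Lemma block_sup_fin_num k x : (1 <= k <= n)%N ->
  block_sup P D f k x = (fine (block_sup P D f k x))%:E.
Proof.
move=> kn; rewrite fineK // ge0_fin_numE ?(block_sup_ge0 DF) //.
have := sum_lty x; rewrite (bigD1_seq k) /= ?mem_index_iota ?iota_uniq //.
have : (0 <= block_sup P D f k x)%E by exact: block_sup_ge0 DF f k x.
case: (block_sup P D f k x) => //= [r _ _|_]; first exact: ltry.
(* An infinite block supremum would make the whole sum of squares infinite. *)
rewrite mulyy addye ?ltxx // gt_eqF // (lt_le_trans (ltNyr 0)) //.
by apply: sume_ge0 => j _; exact: sqre_ge0.
Qed.

Lemma sum_block_sup_le x :
  \sum_(1 <= k < n.+1) fine (block_sup P D f k x) ^+ 2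
    <= fine (square_norm P D n f) ^+ 2.
Proof.
set s := \sum_(_ <= _ < _) _.
have s0 : 0 <= s by apply: sumr_ge0 => k _; exact: sqr_ge0.
have sE : (\sum_(1 <= k < n.+1) `|block_sup P D f k x| ^+ 2)%E = s%:E.
  rewrite /s -sumEFin; apply: eq_big_nat => k kn.
  rewrite gee0_abs ?(block_sup_ge0 DF) // EFin_expe.
  by rewrite {1}block_sup_fin_num.
have := square_function_le_norm DF f n x.
have N_fin : square_norm P D n f \is a fin_num.
  by rewrite ge0_fin_numE //; exact: Lnorm_ge0.
rewrite /square_function sE poweR_EFin powR12_sqrt // -(fineK N_fin) lee_fin.
move=> sN; rewrite -(sqr_sqrtr s0) lerXn2r ?nnegrE ?sqrtr_ge0 //.
exact: le_trans (sqrtr_ge0 _) sN.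
Qed.

End square_norm.

(** * The upper bound *)

Section upper_bound.
Context {R : realType} {d : measure_display} {T : measurableType d}
  {P : probability T R} {D : nat -> set (set T)} {n : nat} {f : nat -> T -> R}.
Hypothesis adm : admissible P D n f.
Context {lambda : R}.
Hypotheses (lambda_gt0 : 0 < lambda) (lambda_lt : lambda < 1 / 2).

Let mdf := admissible_mdiff adm.
Let DF := mdiff_filtration mdf.
Let N : R := fine (square_norm P D n f).
Let b k x : R := fine (block_sup P D f k x).

Let norm_lty : (square_norm P D n f < +oo)%E.
Proof. by have /andP[] := admissible_norm adm. Qed.

Let N_gt0 : 0 < N.
Proof. by rewrite fine_gt0 // (admissible_norm adm). Qed.

(** The argument [t = 1 - 2 lambda s] of [bellman], where [s] is the part of the unit variance
    budget left after [k] steps. *)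
Let remaining k x : R :=
  1 - 2 * lambda * (1 - \sum_(1 <= j < k.+1) (b j x / N) ^+ 2).

(** The process interpolating between the constant bound at [k = 0] and a majorant of the
    exponential at [k = n]; its integrals decrease. *)
Let M k x : R :=
  bellman lambda ((\sum_(1 <= j < k.+1) f j x) / N) (remaining k x).

Let remaining_gt0 k x : 0 < remaining k x.
Proof.
have gt0 (s : R) : 0 <= s -> 0 < 1 - 2 * lambda * (1 - s).
  move=> s0; have h : 0 <= lambda * s by rewrite mulr_ge0 // ltW.
  by have := lambda_lt; lra.
by apply: gt0; apply: sumr_ge0 => j _; exact: sqr_ge0.
Qed.

Let remaining_le1 x : remaining n x <= 1.
Proof.
have le1 (s : R) : s <= 1 -> 1 - 2 * lambda * (1 - s) <= 1.
  move=> s1; have h : lambda * s <= lambda * 1 by rewrite ler_wpM2l // ltW.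
  by lra.
apply: le1; under eq_bigr do rewrite expr_div_n.
rewrite -mulr_suml ler_pdivrMr ?exprn_gt0 // mul1r.
exact: (sum_block_sup_le DF norm_lty x).
Qed.

Let f_blocks k j : (1 <= j <= n)%N -> (j <= k)%N -> constant_on_blocks (D k) (f j).
Proof.
move=> jn jk; apply: (constant_on_blocks_refine DF j k) => //.
have [_ tD _] := dfilt_partition DF j.
apply: measurable_generated_blocks => //; exact: (mdiff_adapted mdf).
Qed.

Let sum_blocks k : (k <= n)%N ->
  constant_on_blocks (D k) (fun x => (\sum_(1 <= j < k.+1) f j x) / N).
Proof.
move=> kn V x y DV Vx Vy; congr (_ / _); apply: eq_big_nat => j /andP[j1 jk].
by apply: (f_blocks k) DV Vx Vy => //; rewrite j1 (leq_trans _ kn).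
Qed.

(** Predictability: [b j] is already determined by the blocks of generation [j.-1], one step before
    [f j]. *)
Let b_blocks k j : (j.-1 <= k)%N -> constant_on_blocks (D k) (b j).
Proof.
move=> jk V x y DV Vx Vy; congr fine.
by apply: (constant_on_blocks_refine DF j.-1 k) DV Vx Vy => //;
  exact: constant_on_blocks_block_sup.
Qed.

Let remaining_blocks k : constant_on_blocks (D k) (remaining k).
Proof.
move=> V x y DV Vx Vy; congr (1 - _ * (1 - _)).
apply: eq_big_nat => j /andP[j1 jk]; congr ((_ / _) ^+ 2).
by apply: (b_blocks k) DV Vx Vy; rewrite (leq_trans (leq_pred j)).
Qed.

Let M_blocks k : (k <= n)%N -> constant_on_blocks (D k) (M k).
Proof.
by move=> kn V x y DV Vx Vy; rewrite /M (sum_blocks k kn _ _ _ DV Vx Vy)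
  (remaining_blocks _ _ _ _ DV Vx Vy).
Qed.

Let M_measurable k : (k <= n)%N -> measurable_fun [set: T] (M k).
Proof.
move=> kn; apply: (measurable_fun_blocks (D k)) (M_blocks k kn).
- exact: dfilt_countable DF k.
- exact: dfilt_partition DF k.
- exact: dfilt_measurable DF k.
Qed.

Let M_ge0 k x : 0 <= M k x.
Proof. by rewrite divr_ge0 ?expR_ge0 ?sqrtr_ge0. Qed.

Let integral_M_decr k : (k < n)%N ->
  (\int[P]_x (M k.+1 x)%:E <= \int[P]_x (M k x)%:E)%E.
Proof.
move=> kn; apply: (le_integral_blocks (D k)).
- exact: dfilt_countable DF k.
- exact: dfilt_partition DF k.
- exact: dfilt_measurable DF k.
- by apply/measurable_EFinP; exact: M_measurable.
- by apply/measurable_EFinP; apply: M_measurable; exact: ltnW.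
- by move=> x; rewrite lee_fin.
- by move=> x; rewrite lee_fin.
move=> V DV; have mV := dfilt_measurable DF DV.
have [_ _ /(_ _ DV)[x0 Vx0]] := dfilt_partition DF k.
set s := (\sum_(1 <= j < k.+1) f j x0) / N; set c := b k.+1 x0 / N.
have kn1 : (1 <= k.+1 <= n)%N by [].
have c_ge0 : 0 <= c by rewrite divr_ge0 ?(ltW N_gt0) // fine_ge0 // block_sup_ge0.
(* By predictability [b k.+1] is constant on [V], so [f k.+1] is the only varying ingredient;
   spending [c ^+ 2] of the budget raises [remaining] by [2 * lambda * c ^+ 2]. *)
have ME x : V x -> M k.+1 x =
    bellman lambda (s + f k.+1 x / N) (remaining k x0 + 2 * lambda * c ^+ 2).
  move=> Vx; rewrite /M big_nat_recr //= mulrDl.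
  rewrite (sum_blocks k (ltnW kn) _ _ _ DV Vx Vx0); congr bellman.
  rewrite (remaining_blocks _ _ _ _ DV Vx0 Vx) /remaining big_nat_recr //=.
  by rewrite /c (b_blocks k k.+1 _ _ _ _ DV Vx0 Vx) //; ring.
rewrite (eq_integral (fun x => (bellman lambda (s + f k.+1 x / N)
    (remaining k x0 + 2 * lambda * c ^+ 2))%:E)); last first.
  by move=> x; rewrite inE => Vx; rewrite ME.
rewrite [leRHS](eq_integral (cst (M k x0)%:E)); last first.
  by move=> x; rewrite inE => Vx; rewrite (M_blocks k (ltnW kn) _ _ _ DV Vx Vx0).
rewrite integral_cst //.
have if_ : P.-integrable V (EFin \o f k.+1).
  exact: integrableS (mdiff_integrable mdf kn1).
apply: integral_bellman_le => //.
- apply: (@eq_measurable_fun _ _ _ _ V (M k.+1)).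
    by move=> x; rewrite inE => Vx; rewrite ME.
  exact/measurable_funTS/M_measurable.
- have -> : EFin \o (fun x => f k.+1 x / N) = (fun x => N^-1%:E * (f k.+1 x)%:E)%E.
    by apply/funext => x /=; rewrite mulrC EFinM.
  exact: integrableZl.
- under eq_integral do rewrite mulrC EFinM.
  by rewrite integralZl // (mdiff_mean0 mdf kn1 DV) mule0.
- have := le_block_sup DF f k.+1 V x0 DV Vx0.
  apply: filterS => x h /h; rewrite (block_sup_fin_num DF norm_lty) // lee_fin => fb.
  by rewrite normrM normfV (gtr0_norm N_gt0) ler_wpM2r ?invr_ge0 ?(ltW N_gt0).
Qed.

Lemma exp_square_moment_le :
  (exp_square_moment P D n f lambda <= (1 / Num.sqrt (1 - 2 * lambda))%:E)%E.
Proof.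
have M0 : (\int[P]_x (M 0 x)%:E = (1 / Num.sqrt (1 - 2 * lambda))%:E)%E.
  rewrite (eq_integral (cst (1 / Num.sqrt (1 - 2 * lambda))%:E)).
    rewrite integral_cst // -[RHS]mule1; congr (_ * _)%E.
    exact: probability_setT.
  move=> x _; rewrite /M /remaining /bellman !big_geq //.
  by rewrite mul0r expr0n /= mulr0 mul0r expR0 subr0 mulr1.
have M_le k : (k <= n)%N ->
    (\int[P]_x (M k x)%:E <= (1 / Num.sqrt (1 - 2 * lambda))%:E)%E.
  elim: k => [|k IHk] kn; first by rewrite M0.
  exact: le_trans (integral_M_decr k kn) (IHk (ltnW kn)).
apply: le_trans (M_le n (leqnn n)); rewrite /exp_square_moment unlock.
apply: ge0_le_integral => //.
- apply/measurable_EFinP; apply: (measurable_fun_blocks (D n)).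
  + exact: dfilt_countable DF n.
  + exact: dfilt_partition DF n.
  + exact: dfilt_measurable DF n.
  + by move=> V x y DV Vx Vy; rewrite -/N (sum_blocks n _ _ _ _ DV Vx Vy).
- by apply/measurable_EFinP; exact: M_measurable.
move=> x _; rewrite lee_fin /M /bellman -/N.
set y := (_ / N) ^+ 2; set t := remaining n x.
have t0 : 0 < t := remaining_gt0 n x.
have t1 : t <= 1 := remaining_le1 x.
(* As [0 < t <= 1], both the division by [Num.sqrt t] and the division of the exponent by [t] can
   only increase the value. *)
rewrite ler_pdivlMr ?sqrtr_gt0 //.
apply: (@le_trans _ _ (expR (lambda * y))).
  by rewrite -[leRHS]mulr1 ler_wpM2l ?expR_ge0 // -sqrtr1 ler_wsqrtr.
rewrite ler_expR ler_pdivlMr // -[leRHS]mulr1 ler_wpM2l //.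
by rewrite mulr_ge0 ?sqr_ge0 // ltW.
Qed.

End upper_bound.

(** * Gaussian moments and the binomial series *)

(** The right side is twice the even part of a binomial expansion, of which the left side keeps the
    two terms of highest degree in [y]. *)
Lemma even_moment_step {R : realDomainType} (m : nat) (y : R) :
  2 * (y ^+ (2 * m.+1) + (m.+1 * (2 * m + 1))%:R * y ^+ (2 * m))
    <= (y + 1) ^+ (2 * m.+1) + (y - 1) ^+ (2 * m.+1).
Proof.
(* The induction needs the companion bound on the difference: multiplying by [(y + 1) ^+ 2] and
   [(y - 1) ^+ 2] mixes the sum and [y] times the difference, with coefficients [y ^+ 2 + 1], [2]
   and [2 * y ^+ 2]. *)
suff : 2 * (y ^+ (2 * m.+1) + (m.+1 * (2 * m + 1))%:R * y ^+ (2 * m))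
    <= (y + 1) ^+ (2 * m.+1) + (y - 1) ^+ (2 * m.+1) /\
    2 * (2 * m.+1)%:R * y ^+ (2 * m.+1)
    <= y * ((y + 1) ^+ (2 * m.+1) - (y - 1) ^+ (2 * m.+1)) by case.
elim: m => [|m [IHe IHo]].
  rewrite muln1 muln0 mul1n add0n expr0 mulr1; split; rewrite -subr_ge0.
    by rewrite (_ : _ - _ = 0) //; ring.
  by rewrite (_ : _ - _ = 0) //; ring.
have y0 : 0 <= y ^+ (2 * m) by rewrite exprM exprn_ge0 ?sqr_ge0.
have y2 : 0 <= y ^+ 2 by exact: sqr_ge0.
move: IHe IHo; rewrite [(2 * m.+2)%N]mulnS [(2 * m.+1)%N]mulnS !addSn !add0n !exprSr.
set p := (y + 1) ^+ (2 * m); set q := (y - 1) ^+ (2 * m); set r := y ^+ (2 * m).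
have -> : (m.+1 * (2 * m + 1))%:R = (m%:R + 1) * (2 * m%:R + 1) :> R.
  by rewrite natrM natrD natrM -[m.+1]addn1 natrD.
have -> : (m.+2 * (2 * m + 1).+2)%:R = (m%:R + 2) * (2 * m%:R + 3) :> R.
  by rewrite -addn2 -[(2 * m + 1).+2]addn2 !(natrD, natrM) /=; ring.
have -> : (2 * m).+2%:R = 2 * m%:R + 2 :> R by rewrite -addn2 natrD natrM.
have -> : (2 * m).+4%:R = 2 * m%:R + 4 :> R by rewrite -addn4 natrD natrM.
have m0 : 0 <= m%:R :> R by exact: ler0n.
move: (m%:R) m0 y0 => u u0 r0 sum_le diff_le.
have ar0 : 0 <= (u + 1) * (2 * u + 1) * r by rewrite !mulr_ge0 // addr_ge0 // mulr_ge0.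
have ry0 : 0 <= r * y ^+ 2 by rewrite mulr_ge0.
have ury0 : 0 <= u * (r * y ^+ 2) by rewrite mulr_ge0.
have ary0 : 0 <= y ^+ 2 * ((u + 1) * (2 * u + 1) * r) by rewrite mulr_ge0.
rewrite -subr_ge0 in sum_le; rewrite -subr_ge0 in diff_le.
have := mulr_ge0 y2 sum_le; have := mulr_ge0 y2 diff_le.
move: sum_le diff_le ar0 ry0 ury0 ary0; clear.
move=> h1 h2 h3 h4 h5 h6 h7 h8; split; lra.
Qed.

(** Pascal's rule for falling factorials; it matches the recursion in [n] of the even moments of
    Rademacher sums. *)
Lemma ffact_natS n m : (n.+1 ^_ m.+1 = n ^_ m.+1 + m.+1 * n ^_ m)%N.
Proof.
rewrite ffactSS ffactnSr; have [nm|mn] := ltnP n m.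
  by rewrite ffact_small // !muln0.
by rewrite [(n ^_ m * _)%N]mulnC -mulnDl addnS subnK.
Qed.

(* [(2m - 1)!!], the moment of order [2m] of a standard Gaussian. *)
Definition odd_fact (m : nat) : nat := \prod_(i < m) (2 * i + 1).

Lemma odd_factS m : odd_fact m.+1 = (odd_fact m * (2 * m + 1))%N.
Proof. by rewrite /odd_fact big_ord_recr. Qed.

(** The term of order [m] in the expansion of [E exp (lambda g^2)] for a standard Gaussian [g], that
    is, in the binomial series of [(1 - 2 lambda)^(-1/2)]. *)
Definition gauss_coef {R : realFieldType} (lambda : R) (m : nat) : R :=
  lambda ^+ m * (odd_fact m)%:R / m`!%:R.

Lemma gauss_coefS {R : realFieldType} (lambda : R) m :
  m.+1%:R * gauss_coef lambda m.+1 = lambda * (2 * m + 1)%:R * gauss_coef lambda m.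
Proof.
rewrite /gauss_coef odd_factS factS exprS !natrM.
by field; rewrite -(natrD _ 1 m) !pnatr_eq0 -lt0n fact_gt0.
Qed.

(** The Cauchy square of the series of [(1 - 2 lambda)^(-1/2)] is the geometric series. The
    induction uses the recurrence [gauss_coefS], which encodes the differential equation of that
    function. *)
Lemma gauss_coef_conv {R : realFieldType} (lambda : R) k :
  \sum_(i < k.+1) gauss_coef lambda i * gauss_coef lambda (k - i) = (2 * lambda) ^+ k.
Proof.
pose b := gauss_coef lambda; rewrite -/b.
(* The symmetry [i <-> n - i] gives the two indices equal weighted sums, and their weights add up to
   [n]. *)
have half n : n%:R * \sum_(i < n.+1) b i * b (n - i)%N =
    2 * \sum_(i < n.+1) i%:R * (b i * b (n - i)%N).
  have rev : \sum_(i < n.+1) i%:R * (b i * b (n - i)%N) =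
      \sum_(i < n.+1) (n - i)%:R * (b i * b (n - i)%N).
    rewrite (reindex_inj rev_ord_inj) /=; apply: eq_bigr => i _.
    by rewrite subSS subKn -1?ltnS // [b _ * _]mulrC.
  rewrite [RHS]mulr_natl mulr2n [X in _ + X]rev -big_split mulr_sumr /=.
  by apply: eq_bigr => i _; rewrite -mulrDl -natrD subnKC // -ltnS.
elim: k => [|k IHk].
  have b0 : b 0%N = 1 by rewrite /b /gauss_coef /odd_fact big_ord0 mulr1 divr1.
  by rewrite big_ord1 subnn /= b0 mulr1.
have k0 : k.+1%:R != 0 :> R by rewrite pnatr_eq0.
apply: (mulfI k0); rewrite half big_ord_recl mul0r add0r exprS.
have -> : \sum_(i < k.+1) (lift ord0 i)%:R * (b (lift ord0 i) * b (k.+1 - lift ord0 i)%N) =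
    lambda * (2 * \sum_(i < k.+1) i%:R * (b i * b (k - i)%N) +
              \sum_(i < k.+1) b i * b (k - i)%N).
  rewrite mulr_sumr -big_split mulr_sumr; apply: eq_bigr => i _.
  rewrite lift0 subSS mulrA gauss_coefS -/b natrD natrM /=; ring.
by rewrite -half IHk -(natr1 k); ring.
Qed.

Lemma gauss_coef_ge0 {R : realFieldType} (lambda : R) m :
  0 <= lambda -> 0 <= gauss_coef lambda m.
Proof. by move=> l0; rewrite !mulr_ge0 ?exprn_ge0 ?invr_ge0 ?ler0n. Qed.

Lemma sum_gauss_coef_sqr_ge {R : realFieldType} (lambda : R) M : 0 <= lambda ->
  \sum_(k < M) (2 * lambda) ^+ k <= (\sum_(i < M) gauss_coef lambda i) ^+ 2.
Proof.
move=> l0; pose b := gauss_coef lambda; rewrite -/b.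
have b0 i : 0 <= b i by exact: gauss_coef_ge0.
pose S n := \sum_(i < n) b i.
(* The products with [i + j < M], regrouped from total degree to first index; the square of the
   partial sum contains them all, besides other nonnegative products. *)
have -> : \sum_(k < M) (2 * lambda) ^+ k = \sum_(i < M) b i * S (M - i)%N.
  elim: M => [|M IHM]; first by rewrite !big_ord0.
  rewrite big_ord_recr /= IHM -gauss_coef_conv -/b.
  have -> : \sum_(i < M) b i * S (M - i)%N = \sum_(i < M.+1) b i * S (M - i)%N.
    by rewrite big_ord_recr /= subnn /S big_ord0 mulr0 addr0.
  rewrite -big_split; apply: eq_bigr => i _ /=.
  by rewrite subSn -1?ltnS // /S big_ord_recr mulrDr.
rewrite expr2 mulr_suml; apply: ler_sum => i _; rewrite ler_wpM2l //.
have S_le k l : (k <= l)%N -> S k <= S l.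
  by move=> kl; rewrite /S -(subnKC kl) big_split_ord /= lerDl sumr_ge0.
exact: S_le (leq_subr _ _).
Qed.

(** The ratio is the product of the factors [1 - i / n] for [i < m], and is at least [1] minus the
    sum of the [i / n]; the constant [m ^ 2] is a crude bound for that sum. *)
Lemma ffact_ratio_ge {R : realFieldType} n m : (0 < n)%N ->
  1 - (m ^ 2)%:R / n%:R <= (n ^_ m)%:R / (n ^ m)%:R :> R.
Proof.
move=> n0; have n0R : 0 < n%:R :> R by rewrite ltr0n.
pose r k : R := (n ^_ k)%:R / (n ^ k)%:R; rewrite -/(r m).
have rS k : r k.+1 = r k * (n - k)%:R / n%:R.
  by rewrite /r ffactnSr expnSr !natrM; field; rewrite !pnatr_eq0 expn_eq0 !eqn0Ngt n0.
have r_ge0 k : 0 <= r k by rewrite divr_ge0.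
have r_le1 k : r k <= 1.
  elim: k => [|k IHk]; first by rewrite /r divr1.
  rewrite rS -mulrA mulr_ile1 ?divr_ge0 //.
  by rewrite ler_pdivrMr // mul1r ler_nat leq_subr.
elim: m => [|m IHm]; first by rewrite /r !divr1 mul0r subr0.
(* For [n < m] the subtraction of naturals is truncated to [0], which is still above the negative
   real difference. *)
have sub_ge : n%:R - m%:R <= (n - m)%:R :> R.
  have [mn|/ltnW nm] := leqP m n; first by rewrite natrB.
  by rewrite (le_trans _ (ler0n _ _)) // subr_le0 ler_nat.
rewrite rS; apply: (@le_trans _ _ (r m * (1 - m%:R / n%:R))).
  apply: (@le_trans _ _ (r m - m%:R / n%:R)); last first.
    rewrite mulrBr mulr1 lerD2l lerN2 ler_piMl // divr_ge0 //.
  apply: le_trans (lerD IHm (lexx _)).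
  rewrite -addrA -opprD lerD2l lerN2 -mulrDl ler_wpM2r ?invr_ge0 //.
  rewrite -natrD ler_nat; lia.
rewrite -mulrA ler_wpM2l // ler_pdivlMr // mulrBl mul1r divfK ?gt_eqF //.
Qed.

(** First [n] tends to infinity with [M] fixed, which removes the falling factorial ratio; then [M]
    tends to infinity, where comparing squares with the geometric series avoids summing the binomial
    series. *)
Lemma gauss_constant_le {R : realType} (lambda C : R) :
    0 < lambda -> lambda < 1 / 2 ->
    (forall M n, (0 < n)%N ->
      \sum_(m < M) gauss_coef lambda m * ((n ^_ m)%:R / (n ^ m)%:R) <= C) ->
  1 / Num.sqrt (1 - 2 * lambda) <= C.
Proof.
move=> l0 l1 hC; pose b := gauss_coef lambda.
have b0 m : 0 <= b m by rewrite gauss_coef_ge0 // ltW.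
have sum_le M : \sum_(m < M) b m <= C.
  pose K := \sum_(m < M) b m * (m ^ 2)%:R.
  have le_n n : (0 < n)%N -> \sum_(m < M) b m - C <= K / n%:R.
    move=> n0; rewrite lerBlDr -lerBlDl; apply: le_trans (hC M n n0).
    rewrite /K mulr_suml -sumrB; apply: ler_sum => m _.
    by have := ler_wpM2l (b0 m) (ffact_ratio_ge n m n0); rewrite mulrBr mulr1 mulrA.
  rewrite leNgt -subr_gt0; apply/negP; set e := _ - C => e0.
  have K0 : 0 <= K by rewrite sumr_ge0 // => m _; rewrite mulr_ge0.
  (* An excess [e > 0] would be at most [K / n] for every positive [n], contradicted by an [n] above
     [K / e]. *)
  have := le_n (Num.truncn (K / e)).+1 (ltn0Sn _).
  rewrite -/e leNgt ltr_pdivrMr ?ltr0n // -ltr_pdivrMl //.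
  by rewrite mulrC truncnS_gt ?divr_ge0 // ltW.
have C0 : 0 <= C by have := sum_le 0%N; rewrite big_ord0.
have x0 : 0 < 1 - 2 * lambda by lra.
have C2 : 1 <= (1 - 2 * lambda) * C ^+ 2.
  have pow_ge M : 1 - (1 - 2 * lambda) * C ^+ 2 <= (2 * lambda) ^+ M.
    have : (1 - 2 * lambda) * \sum_(k < M) (2 * lambda) ^+ k <= (1 - 2 * lambda) * C ^+ 2.
      rewrite ler_wpM2l ?(ltW x0) //.
      apply: le_trans (sum_gauss_coef_sqr_ge lambda M (ltW l0)) _.
      by rewrite lerXn2r ?nnegrE ?sum_le // sumr_ge0.
    by rewrite -opprB mulNr -subrX1 opprB; lra.
  have pow_cvg : ((2 * lambda) ^+ M)%R @[M --> \oo] --> (0 : R).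
    by apply: cvg_expr; rewrite ger0_norm; lra.
  rewrite -subr_le0; apply: (ler_cvg_to (cvg_cst _) pow_cvg).
  by apply: nearW.
rewrite ler_pdivrMr ?sqrtr_gt0 // -(ler_pXn2r (ltn0Sn 1)) ?nnegrE ?mulr_ge0 ?sqrtr_ge0 //.
by rewrite expr1n exprMn sqr_sqrtr ?(ltW x0) // mulrC.
Qed.

(** * The dyadic filtration of the unit interval *)

Section dyadic_intervals.
Context {R : realType}.
Notation X := (unit_interval R).
Notation leb := (@unit_lebesgue R).
Notation DI := (@dyadic_intervals R).

Let val_ge0 (x : X) : 0 <= unit_interval_val x :> R.
Proof. by have /andP[] := valP x. Qed.

Let val_lt1 (x : X) : unit_interval_val x < 1 :> R.
Proof. by have /andP[] := valP x. Qed.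

Definition dyadic_index (k : nat) (x : X) : nat :=
  Num.truncn (2 ^+ k * unit_interval_val x).

(** Dyadic intervals as level sets of an integer-valued function, so that disjointness, covering and
    refinement become statements about indices; here [j] starts from [0]. *)
Definition dyadic_block (k j : nat) : set X := [set x | dyadic_index k x = j].

Lemma dyadic_blockE k j : dyadic_block k j =
  [set x | j%:R / 2 ^+ k <= unit_interval_val x < j.+1%:R / 2 ^+ k].
Proof.
have pow0 : 0 < 2 ^+ k :> R by rewrite exprn_gt0.
apply/seteqP; split => x /=; rewrite /dyadic_index /=;
  have x0 : 0 <= 2 ^+ k * unit_interval_val x :> R by
    rewrite mulr_ge0 ?(ltW pow0).
- by move/eqP; rewrite truncn_eq // ler_pdivrMr // ltr_pdivlMr // mulrC.
- by move=> h; apply/eqP; rewrite truncn_eq // [_ * unit_interval_val x]mulrC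
    -ler_pdivrMr // -ltr_pdivlMr.
Qed.

Lemma dyadic_index_ge k x : (dyadic_index k x)%:R <= 2 ^+ k * unit_interval_val x.
Proof.
by rewrite truncn_le // mulr_ge0 ?exprn_ge0.
Qed.

Lemma dyadic_index_lt k x : (dyadic_index k x < 2 ^ k)%N.
Proof.
rewrite -(ltr_nat R) natrX; apply: le_lt_trans (dyadic_index_ge k x) _.
by rewrite gtr_pMr ?exprn_gt0.
Qed.

(** Halving drops the last binary digit; hence the children of block [j] are blocks [2 * j] and
    [2 * j + 1]. *)
Lemma dyadic_index_half k x : (dyadic_index k.+1 x)./2 = dyadic_index k x.
Proof.
have x0 : 0 <= 2 ^+ k * unit_interval_val x :> R by rewrite mulr_ge0 ?exprn_ge0.
have x1 : 0 <= 2 ^+ k.+1 * unit_interval_val x :> R by rewrite mulr_ge0 ?exprn_ge0.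
have := truncn_itv x1; rewrite -/(dyadic_index k.+1 x) exprS -mulrA.
set m := dyadic_index k.+1 x; set y := 2 ^+ k * _ => /andP[my ym].
apply/esym/eqP; rewrite truncn_eq // -/y.
have := odd_double_half m; rewrite -muln2 => mE.
have m_le : (m <= m./2 * 2 + 1)%N by rewrite -[leqLHS]mE; case: odd; lia.
have m_ge : (m./2 * 2 <= m)%N by rewrite -[leqRHS]mE; case: odd; lia.
move: m_le m_ge; rewrite -!(ler_nat R) natrD natrM => m_le m_ge.
by rewrite -!natr1 in ym *; apply/andP; split; lra.
Qed.

Lemma dyadic_intervalsE k : DI k = [set dyadic_block k j | j in [set j | (j < 2 ^ k)%N]].
Proof.
have blockE j : dyadic_block k j =
    [set x | (j.+1%:R - 1) / 2 ^+ k <= unit_interval_val x < j.+1%:R / 2 ^+ k].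
  by rewrite dyadic_blockE -(natr1 j) addrK.
apply/seteqP; split => V [j /=].
  by case: j => // j /= jk <-; exists j.
by move=> jk <-; exists j.+1.
Qed.

Lemma dyadic_block_in k x : DI k (dyadic_block k (dyadic_index k x)).
Proof. by rewrite dyadic_intervalsE; exists (dyadic_index k x) => //=; exact: dyadic_index_lt. Qed.

Lemma dyadic_block_image k j : (j < 2 ^ k)%N ->
  @unit_interval_val R @` dyadic_block k j = `[j%:R / 2 ^+ k, j.+1%:R / 2 ^+ k[%classic.
Proof.
move=> jk; rewrite dyadic_blockE; apply/seteqP; split => x /=.
  by move=> [y yj <-]; rewrite in_itv.
rewrite in_itv /= => /andP[jx xj].
have x01 : 0 <= x < 1.
  rewrite (le_trans _ jx) ?divr_ge0 ?exprn_ge0 //= (lt_le_trans xj) //.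
  by rewrite ler_pdivrMr ?exprn_gt0 // mul1r -natrX ler_nat.
by exists (exist _ x x01) => //=; rewrite jx.
Qed.

Lemma measurable_dyadic_block k j : measurable (dyadic_block k j).
Proof.
exists `[j%:R / 2 ^+ k, j.+1%:R / 2 ^+ k[%classic; first exact: measurable_itv.
rewrite setTI dyadic_blockE; apply/seteqP; split => x /=; by rewrite in_itv.
Qed.

Lemma dyadic_block_measure k j : (j < 2 ^ k)%N ->
  leb (dyadic_block k j) = ((2 ^+ k)^-1)%:E.
Proof.
move=> jk; rewrite /unit_lebesgue dyadic_block_image // lebesgue_measure_itv /=.
rewrite lte_fin ltr_pM2r ?invr_gt0 ?exprn_gt0 // ltr_nat leqnn -EFinB.
by rewrite -mulrBl -natr1 [_ + 1]addrC addrK mul1r.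
Qed.

Lemma dyadic_block_split k j : dyadic_block k j =
  dyadic_block k.+1 (2 * j) `|` dyadic_block k.+1 (2 * j + 1).
Proof.
apply/seteqP; split => x /=; rewrite /dyadic_block /= -(dyadic_index_half k x).
  by move=> <-; have := odd_double_half (dyadic_index k.+1 x); case: odd => h; [right|left]; lia.
by case=> ->; lia.
Qed.

Lemma dyadic_block_disj k i j : i <> j -> dyadic_block k i `&` dyadic_block k j = set0.
Proof. by move=> ij; apply/seteqP; split => // x [/= ix jx]; apply: ij; rewrite -ix. Qed.

Lemma dyadic_filtration : discrete_filtration leb DI.
Proof.
split.
- move=> k; rewrite dyadic_intervalsE.
  by apply: sub_countable (card_image_le _ _) _; exact: countableP.
- move=> k; split.
  + apply/seteqP; split => // x _; exists (dyadic_block k (dyadic_index k x)) => //.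
    exact: dyadic_block_in.
  + move=> V W; rewrite dyadic_intervalsE => -[i _ <-] [j _ <-] [x [/= xi xj]].
    by rewrite -[i]xi -[j]xj.
  + move=> V DV; apply/set0P/negP => /eqP V0.
    move: DV; rewrite dyadic_intervalsE => -[j /= jk jV].
    have := dyadic_block_measure k j jk; rewrite jV V0 measure0 => /esym/eqP.
    by rewrite eqe invr_eq0 expf_eq0 pnatr_eq0 andbF.
- move=> k V; rewrite dyadic_intervalsE => -[j _ <-]; exact: measurable_dyadic_block.
- move=> k V; rewrite dyadic_intervalsE => -[j jk <-].
  suff : (0 < leb (dyadic_block k j))%E by [].
  by rewrite dyadic_block_measure // lte_fin invr_gt0 exprn_gt0.
- rewrite dyadic_intervalsE; have blockT : dyadic_block 0 0 = [set: X].
    by apply/seteqP; split => // x _; have := dyadic_index_lt 0 x; rewrite /dyadic_block /=; lia.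
  apply/seteqP; split => [V [j /= j1 <-]|V -> /=].
    by have -> : j = 0%N by lia.
  by exists 0%N.
- move=> k V; rewrite dyadic_intervalsE => -[j /= jk <-].
  exists [set dyadic_block k.+1 (2 * j); dyadic_block k.+1 (2 * j + 1)].
    move=> W; rewrite dyadic_intervalsE; case=> ->.
      by exists (2 * j)%N => //=; rewrite expnS; lia.
    by exists (2 * j + 1)%N => //=; rewrite expnS; lia.
  by rewrite bigcup_setU !bigcup_set1 dyadic_block_split.
Qed.

Lemma dyadic_intervals_dyadic n : dyadic leb DI n.
Proof.
move=> k V _; rewrite {1}dyadic_intervalsE => -[j /= jk <-].
have j0 : (2 * j < 2 ^ k.+1)%N by rewrite expnS; lia.
have j1 : (2 * j + 1 < 2 ^ k.+1)%N by rewrite expnS; lia.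
have DI0 : DI k.+1 (dyadic_block k.+1 (2 * j)) by rewrite dyadic_intervalsE; exists (2 * j)%N.
have DI1 : DI k.+1 (dyadic_block k.+1 (2 * j + 1)).
  by rewrite dyadic_intervalsE; exists (2 * j + 1)%N.
have [_ _ ne] := dfilt_partition dyadic_filtration k.+1.
have half : (2 ^+ k.+1)^-1 = (2 ^+ k)^-1 * 2^-1 :> R by rewrite exprS invfM mulrC.
exists (dyadic_block k.+1 (2 * j)), (dyadic_block k.+1 (2 * j + 1)); split.
- move=> E; have [x x0] := ne _ DI0; have := x0; rewrite /= E.
  by rewrite /dyadic_block /= x0; lia.
- rewrite dyadic_block_split; apply/seteqP; split => U.
  + move=> [DU UV]; have [x Ux] := ne _ DU; have Vx := UV _ Ux; move: DU Vx Ux.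
    by rewrite dyadic_intervalsE => -[i _ <-] /= [] <- <-; [left|right].
  + case=> ->; first by split => //; exact: subsetUl.
    by split => //; exact: subsetUr.
- suff : leb (dyadic_block k.+1 (2 * j)) = (leb (dyadic_block k j) * 2^-1%:E)%E by [].
  by rewrite !dyadic_block_measure // half.
- suff : leb (dyadic_block k.+1 (2 * j + 1)) = (leb (dyadic_block k j) * 2^-1%:E)%E by [].
  by rewrite !dyadic_block_measure // half.
Qed.

End dyadic_intervals.

(** * Rademacher martingales *)

Section rademacher_signs.
Context {R : realType}.
Notation X := (unit_interval R).
Notation leb := (@unit_lebesgue R).
Notation DI := (@dyadic_intervals R).
Let DF := @dyadic_filtration R.

(* The version of [rademacher k] that is constant on the dyadic intervals of
   generation [k], hence adapted. *)
Definition rademacher_sign (k : nat) (x : X) : R := (-1) ^+ dyadic_index k x.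

Lemma rademacher_sign_norm k x : `|rademacher_sign k x| = 1.
Proof. by rewrite normrX normrN1 expr1n. Qed.

Lemma rademacher_sign_blocks k : constant_on_blocks (DI k) (rademacher_sign k).
Proof.
move=> V x y; rewrite dyadic_intervalsE => -[j _ <-] /= xj yj.
by rewrite /rademacher_sign xj yj.
Qed.

Lemma measurable_dyadic_blocks_fun {d'} {W : measurableType d'} k (g : X -> W) :
  constant_on_blocks (DI k) g -> measurable_fun [set: X] g.
Proof.
apply: measurable_fun_blocks.
- exact: dfilt_countable DF k.
- exact: dfilt_partition DF k.
- exact: dfilt_measurable DF k.
Qed.

Lemma measurable_rademacher_sign k : measurable_fun [set: X] (rademacher_sign k).
Proof. exact: measurable_dyadic_blocks_fun (rademacher_sign_blocks k). Qed.

(** The sign is [1] on the child of even index and [-1] on the other, each of half the mass. A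
    general [u] serves both the mean-zero property and the moments. *)
Lemma integral_rademacher_sign (u : R -> R) k j : (j < 2 ^ k)%N ->
  (\int[leb]_(x in dyadic_block k j) (u (rademacher_sign k.+1 x))%:E =
    ((u 1 + u (-1)) / 2 / 2 ^+ k)%:E)%E.
Proof.
move=> jk.
have j0 : (2 * j < 2 ^ k.+1)%N by rewrite expnS; lia.
have j1 : (2 * j + 1 < 2 ^ k.+1)%N by rewrite expnS; lia.
have mu_ : measurable_fun [set: X] (fun x => u (rademacher_sign k.+1 x)).
  apply: (measurable_dyadic_blocks_fun k.+1) => V x y DV Vx Vy.
  by congr u; exact: rademacher_sign_blocks DV Vx Vy.
rewrite dyadic_block_split integral_setU; first last.
- by rewrite disj_set2E; apply/eqP; apply: dyadic_block_disj; lia.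
- by apply: measurable_funTS; apply/measurable_EFinP.
- exact: measurable_dyadic_block.
- exact: measurable_dyadic_block.
rewrite (eq_integral (cst (u 1)%:E)); last first.
  move=> x; rewrite inE /dyadic_block /= /rademacher_sign => ->.
  by rewrite exprM sqrrN !expr1n.
rewrite [X in (_ + X)%E](eq_integral (cst (u (-1))%:E)); last first.
  move=> x; rewrite inE /dyadic_block /= /rademacher_sign => ->.
  by rewrite exprD exprM sqrrN !expr1n mul1r.
rewrite !integral_cst; [|exact: measurable_dyadic_block..].
have mE i : (i < 2 ^ k.+1)%N -> leb (dyadic_block k.+1 i) = ((2 ^+ k.+1)^-1)%:E.
  exact: dyadic_block_measure.
transitivity ((u 1)%:E * leb (dyadic_block k.+1 (2 * j)) +
  (u (-1))%:E * leb (dyadic_block k.+1 (2 * j + 1)))%E => //.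
rewrite !mE // -!EFinM -EFinD exprS; congr EFin.
by field; rewrite expf_neq0.
Qed.

Lemma rademacher_sign_mdiff n : martingale_difference leb DI n rademacher_sign.
Proof.
split.
- exact: DF.
- move=> k _; apply: measurable_bounded_integrable => //.
  + suff : (leb [set: X] < +oo)%E by [].
    by rewrite (_ : leb _ = 1%E) ?ltry //; exact: probability_setT.
  + exact: measurable_rademacher_sign.
  + exists 1; split => // M M1 x _ /=; rewrite rademacher_sign_norm; exact: ltW.
(* The ambient measurable structure is here the $\sigma$-algebra generated by the partition, as
   adaptedness demands. *)
- move=> k _; apply: (@measurable_fun_blocks _ (g_sigma_algebraType (DI k)) (DI k)).
  + exact: dfilt_countable DF k.
  + exact: dfilt_partition DF k.
  + by move=> V DV; exact: sub_sigma_algebra.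
  + exact: rademacher_sign_blocks.
- move=> [//|k] V _ /=; rewrite dyadic_intervalsE => -[j /= jk <-].
  by rewrite (integral_rademacher_sign id) // subrr !mul0r.
Qed.

Lemma block_sup_rademacher_sign k x : block_sup leb DI rademacher_sign k x = 1%E.
Proof.
have [V DV Vx] := block_of DF k.-1 x.
rewrite (block_supE DF _ k V x DV Vx) Lnormy_ess_sup; apply/eqP; rewrite eq_le; apply/andP; split.
  apply/ess_supP => //; apply: nearW => y /=; rewrite lee_fin normrM rademacher_sign_norm mulr1.
  by rewrite indicE; case: (_ \in _); rewrite ?normr1 ?normr0.
have := ess_sup_ge leb (abse \o (EFin \o (\1_V \* rademacher_sign k))).
move=> /(ae_exists leb V _ (dfilt_measurable DF DV) (dfilt_pos DF DV))[y Vy].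
by rewrite /= indicE mem_set // mul1r rademacher_sign_norm.
Qed.

Lemma square_norm_rademacher_sign n :
  square_norm leb DI n rademacher_sign = (Num.sqrt n%:R)%:E.
Proof.
have -> : square_norm leb DI n rademacher_sign = ('N[leb]_+oo[cst (Num.sqrt n%:R)%:E])%E.
  apply: eq_Lnorm => x; rewrite /square_function.
  under eq_bigr do rewrite block_sup_rademacher_sign.
  rewrite (eq_bigr (fun=> 1%:E)); last by move=> k _; rewrite abse1 expe2 mule1.
  by rewrite sumEFin poweR_EFin powR12_sqrt sumr_const_nat subn1 ?mulrn_wge0.
rewrite Lnormy_ess_sup.
have -> : abse \o cst (Num.sqrt n%:R)%:E = cst (Num.sqrt n%:R : R)%:E :> (X -> \bar R).
  by apply/funext => x /=; rewrite ger0_norm ?sqrtr_ge0.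
apply: ess_sup_cst; suff : (0 < leb [set: X])%E by [].
by rewrite (_ : leb _ = 1%E) ?lte01 //; exact: probability_setT.
Qed.

Lemma rademacher_sign_admissible n : (0 < n)%N -> admissible leb DI n rademacher_sign.
Proof.
move=> n0; split => //; first exact: rademacher_sign_mdiff.
by rewrite square_norm_rademacher_sign ltry lte_fin sqrtr_gt0 ltr0n n0.
Qed.

(** The exceptional set consists of the dyadic points, a countable set. Elsewhere [2 ^+ k * x] lies
    strictly between [j] and [j + 1], where the sine of its product with [pi] has sign
    [(-1) ^+ j]. *)
Lemma rademacher_sign_ae k : {ae leb, forall x, rademacher_sign k x = rademacher k x}.
Proof.
pose N := @unit_interval_val R @^-1` (range (fun j : nat => j%:R / 2 ^+ k)).
have N_countable : countable (range (fun j : nat => j%:R / 2 ^+ k : R)).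
  by apply: sub_countable (card_image_le _ _) _; exact: countableP.
have mN : measurable N.
  exists (range (fun j : nat => j%:R / 2 ^+ k)); last by rewrite setTI.
  exact: countable_measurable.
exists N; split => //.
  suff : leb N = 0%E by [].
  apply: (@countable_lebesgue_measure0 R).
  apply: sub_countable N_countable; apply: subset_card_le => _ [x [j _ jx] <-].
  by exists j.
move=> x /= neq; apply: contrapT => xN; apply: neq.
have v0 : 0 <= 2 ^+ k * unit_interval_val x :> R.
  by rewrite mulr_ge0 ?exprn_ge0 //; have /andP[] := valP x.
have /andP[jx xj] := truncn_itv v0; rewrite -/(dyadic_index k x) in jx xj.
rewrite /rademacher_sign /rademacher.
set j := dyadic_index k x in jx xj *; set y := 2 ^+ k * unit_interval_val x in jx xj *.
have jy : j%:R < y.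
  rewrite lt_neqAle jx andbT; apply/eqP => jE; apply: xN; exists j => //.
  by rewrite jE /y [2 ^+ k * _]mulrC mulfK // expf_neq0.
have sinE : sin (2 ^+ k * pi * unit_interval_val x) = (-1) ^+ j * sin ((y - j%:R) * pi).
  have -> : 2 ^+ k * pi * unit_interval_val x = (y - j%:R) * pi + pi *+ j.
    by rewrite /y -mulr_natr; ring.
  by rewrite (alternatingn (@sinDpi R)).
have sin_gt0 : 0 < sin ((y - j%:R) * pi).
  apply: sin_gt0_pi; rewrite mulr_gt0 ?subr_gt0 ?pi_gt0 //=.
  by rewrite gtr_pMl ?pi_gt0 //; rewrite -natr1 in xj; lra.
by rewrite sinE sgrM sgrX sgrN1 (gtr0_sg sin_gt0) mulr1.
Qed.

End rademacher_signs.

(** * Even moments of Rademacher sums *)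

Lemma sum_exp_coeff_le {R : realType} (x : R) M : 0 <= x ->
  \sum_(m < M) x ^+ m / m`!%:R <= expR x.
Proof.
move=> x0; have -> : \sum_(m < M) x ^+ m / m`!%:R = series (exp_coeff x) M.
  by rewrite /series /= big_mkord.
apply: nondecreasing_cvgn_le (is_cvg_series_exp_coeff x) M.
apply/nondecreasing_seqP => k; rewrite seriesSr lerDl.
by rewrite divr_ge0 ?exprn_ge0.
Qed.

Section rademacher_moments.
Context {R : realType}.
Notation X := (unit_interval R).
Notation leb := (@unit_lebesgue R).
Notation DI := (@dyadic_intervals R).
Let DF := @dyadic_filtration R.

Let S n (x : X) : R := \sum_(1 <= k < n.+1) rademacher_sign k x.

Let S_blocks k : constant_on_blocks (DI k) (S k).
Proof.
move=> V x y DV Vx Vy; apply: eq_big_nat => j /andP[_ jk].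
exact: (constant_on_blocks_refine DF j k _ _ (rademacher_sign_blocks j)) DV Vx Vy.
Qed.

Let measurable_S (h : R -> R) k : measurable_fun [set: X] (fun x => (h (S k x))%:E).
Proof.
apply/measurable_EFinP; apply: (measurable_dyadic_blocks_fun k) => V x y DV Vx Vy.
by rewrite (S_blocks k V x y).
Qed.

Let pow_ge0 (y : R) m : 0 <= y ^+ (2 * m).
Proof. by rewrite exprM exprn_ge0 ?sqr_ge0. Qed.

(** On a block of generation [k] the sum has a constant value [s], and the next sign averages
    [s + 1] and [s - 1] with equal weights; [even_moment_step] then applies blockwise. *)
Lemma rademacher_moment_step k m :
  (\int[leb]_x (S k x ^+ (2 * m.+1))%:E +
     (m.+1 * (2 * m + 1))%:R%:E * \int[leb]_x (S k x ^+ (2 * m))%:E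
   <= \int[leb]_x (S k.+1 x ^+ (2 * m.+1))%:E)%E.
Proof.
pose a : R := (m.+1 * (2 * m + 1))%:R.
rewrite -ge0_integralZl_EFin //; last 2 first.
- by move=> x _; rewrite lee_fin pow_ge0.
- exact: (measurable_S (fun y => y ^+ (2 * m))).
rewrite -ge0_integralD //; last 4 first.
- by move=> x _; rewrite lee_fin pow_ge0.
- exact: (measurable_S (fun y => y ^+ (2 * m.+1))).
- by move=> x _; rewrite -EFinM lee_fin mulr_ge0 ?pow_ge0.
- exact: (measurable_S (fun y => a * y ^+ (2 * m))).
apply: (le_integral_blocks (DI k)).
- exact: dfilt_countable DF k.
- exact: dfilt_partition DF k.
- exact: dfilt_measurable DF k.
- exact: (measurable_S (fun y => y ^+ (2 * m.+1) + a * y ^+ (2 * m))).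
- exact: (measurable_S (fun y => y ^+ (2 * m.+1))).
- by move=> x; rewrite -EFinM -EFinD lee_fin addr_ge0 ?mulr_ge0 ?pow_ge0.
- by move=> x; rewrite lee_fin pow_ge0.
move=> V DV; have [_ _ /(_ _ DV)[x0 Vx0]] := dfilt_partition DF k.
have SE x : V x -> S k x = S k x0 by move=> Vx; exact: S_blocks DV Vx Vx0.
have SSE x : V x -> S k.+1 x = S k x0 + rademacher_sign k.+1 x.
  by move=> Vx; rewrite /S big_nat_recr //= -/(S k x) SE.
have mV := dfilt_measurable DF DV; set s := S k x0 in SE SSE.
rewrite (eq_integral (cst (s ^+ (2 * m.+1) + a * s ^+ (2 * m))%:E)); last first.
  by move=> x; rewrite inE => Vx; rewrite SE.
rewrite [leRHS](eq_integral (fun x => ((s + rademacher_sign k.+1 x) ^+ (2 * m.+1))%:E)); last first.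
  by move=> x; rewrite inE => Vx; rewrite SSE.
rewrite integral_cst //; move: DV; rewrite dyadic_intervalsE => -[j /= jk <-].
rewrite (integral_rademacher_sign (fun y => (s + y) ^+ (2 * m.+1))) //.
suff : ((s ^+ (2 * m.+1) + a * s ^+ (2 * m))%:E * leb (dyadic_block k j) <=
   (((s + 1) ^+ (2 * m.+1) + (s - 1) ^+ (2 * m.+1)) / 2 / 2 ^+ k)%:E)%E by [].
rewrite dyadic_block_measure // -EFinM lee_fin ler_wpM2r ?invr_ge0 ?exprn_ge0 //.
by rewrite ler_pdivlMr // mulrC even_moment_step.
Qed.

Lemma rademacher_moment_ge n m :
  ((odd_fact m * n ^_ m)%:R%:E <= \int[leb]_x (S n x ^+ (2 * m))%:E)%E.
Proof.
have moment_ge0 k l : (0 <= \int[leb]_x (S k x ^+ (2 * l))%:E)%E.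
  by apply: integral_ge0 => x _; rewrite lee_fin pow_ge0.
have moment0 k : (\int[leb]_x (S k x ^+ (2 * 0))%:E = 1)%E.
  under eq_integral do rewrite muln0 expr0.
  rewrite integral_cst // mul1e; exact: probability_setT.
(* The order [m] stays universally quantified, since the moment of order [m.+1] at [n.+1] uses both
   orders [m] and [m.+1] at [n]. *)
elim: n m => [|n IHn] [|m].
- by rewrite moment0 /odd_fact big_ord0 ffactn0.
- by rewrite ffact0n muln0 moment_ge0.
- by rewrite moment0 /odd_fact big_ord0 ffactn0.
apply: le_trans (rademacher_moment_step n m).
rewrite ffact_natS mulnDr natrD EFinD; apply: leeD; first exact: IHn.
have -> : (odd_fact m.+1 * (m.+1 * n ^_ m) = (m.+1 * (2 * m + 1)) * (odd_fact m * n ^_ m))%N.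
  by rewrite odd_factS; lia.
rewrite natrM EFinM; apply: lee_wpmul2l; last exact: IHn.
by rewrite lee_fin.
Qed.

Lemma rademacher_exp_square_moment_ge (lambda : R) n M : 0 < lambda -> (0 < n)%N ->
  ((\sum_(m < M) gauss_coef lambda m * ((n ^_ m)%:R / (n ^ m)%:R))%:E
    <= exp_square_moment leb DI n rademacher_sign lambda)%E.
Proof.
move=> l0 n0; have n0R : 0 < n%:R :> R by rewrite ltr0n.
(* The coefficient of [S n x ^+ (2 * m)] in the expansion of [expR (lambda * S n x ^+ 2 / n)], the
   norm of the square function being [Num.sqrt n%:R]. *)
pose c m : R := lambda ^+ m / m`!%:R / (n ^ m)%:R.
have c0 m : 0 <= c m by rewrite !divr_ge0 ?exprn_ge0 ?(ltW l0).
apply: (@le_trans _ _ (\int[leb]_x (\sum_(m < M) (c m)%:E * (S n x ^+ (2 * m))%:E))%E).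
  rewrite ge0_integral_sum //; last 2 first.
  - by move=> m; exact: (measurable_S (fun y => c m * y ^+ (2 * m))).
  - by move=> m x _; rewrite -EFinM lee_fin mulr_ge0 ?pow_ge0.
  rewrite -sumEFin; apply: lee_sum => m _.
  rewrite ge0_integralZl_EFin //; last 2 first.
  - by move=> x _; rewrite lee_fin pow_ge0.
  - exact: (measurable_S (fun y => y ^+ (2 * m))).
  apply: le_trans (lee_wpmul2l _ (rademacher_moment_ge n m)); last by rewrite lee_fin.
  rewrite -EFinM lee_fin /c /gauss_coef natrM le_eqVlt; apply/predU1P; left.
  by field; rewrite !pnatr_eq0 expn_eq0 !eqn0Ngt n0 fact_gt0.
rewrite /exp_square_moment expectation.unlock square_norm_rademacher_sign /=.
apply: ge0_le_integral => //.
- by move=> x _; apply: sume_ge0 => m _; rewrite -EFinM lee_fin mulr_ge0 ?pow_ge0.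
- under eq_fun do rewrite sumEFin.
  exact: (measurable_S (fun y => \sum_(m < M) c m * y ^+ (2 * m))).
- exact: (measurable_S (fun y => expR (lambda * (y / Num.sqrt n%:R) ^+ 2))).
move=> x _; rewrite sumEFin lee_fin -/(S n x).
rewrite expr_div_n sqr_sqrtr ?(ltW n0R) //.
set y := S n x; have z0 : 0 <= lambda * (y ^+ 2 / n%:R).
  by rewrite mulr_ge0 ?(ltW l0) // divr_ge0 ?sqr_ge0.
apply: le_trans (sum_exp_coeff_le _ M z0); apply: ler_sum => m _.
rewrite /c exprMn expr_div_n natrX exprM le_eqVlt; apply/predU1P; left.
by field; rewrite expf_neq0 ?gt_eqF // ltr0n fact_gt0.
Qed.

End rademacher_moments.

Theorem corollary1p3 (R : realType) (lambda : R)
    (lambda_gt0 : 0 < lambda) (lambda_lt : lambda < 1 / 2) :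
  [/\ (forall (d : measure_display) (T : measurableType d)
          (P : probability T R) (D : nat -> set (set T)) (n : nat)
          (f : nat -> T -> R),
        admissible P D n f ->
        (exp_square_moment P D n f lambda
          <= (1 / Num.sqrt (1 - 2 * lambda))%:E)%E),
      (forall C : R,
        (forall (d : measure_display) (T : measurableType d)
            (P : probability T R) (D : nat -> set (set T)) (n : nat)
            (f : nat -> T -> R),
          admissible P D n f ->
          (exp_square_moment P D n f lambda <= C%:E)%E) ->
        1 / Num.sqrt (1 - 2 * lambda) <= C),
      (forall C : R,
        (forall (d : measure_display) (T : measurableType d)
            (P : probability T R) (D : nat -> set (set T)) (n : nat)
            (f : nat -> T -> R),
          admissible P D n f -> dyadic P D n ->
          (exp_square_moment P D n f lambda <= C%:E)%E) ->
        1 / Num.sqrt (1 - 2 * lambda) <= C)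
    & (forall C : R,
        (forall (n : nat) (f : nat -> unit_interval R -> R),
          admissible (@unit_lebesgue R) (@dyadic_intervals R) n f ->
          rademacher_sequence n f ->
          (exp_square_moment (@unit_lebesgue R) (@dyadic_intervals R) n f
             lambda <= C%:E)%E) ->
        1 / Num.sqrt (1 - 2 * lambda) <= C)].
Proof.
(* A bound required only of Rademacher martingales is the weakest of the three assumptions on [C],
   so this case implies the other two. *)
have rademacher_best C :
    (forall n (f : nat -> unit_interval R -> R),
      admissible (@unit_lebesgue R) (@dyadic_intervals R) n f ->
      rademacher_sequence n f ->
      (exp_square_moment (@unit_lebesgue R) (@dyadic_intervals R) n f lambda
        <= C%:E)%E) ->
    1 / Num.sqrt (1 - 2 * lambda) <= C.
  move=> hC; apply: gauss_constant_le => // M n n0; rewrite -lee_fin.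
  apply: le_trans (rademacher_exp_square_moment_ge lambda n M lambda_gt0 n0) _.
  apply: hC; first exact: rademacher_sign_admissible.
  (* All coefficients [a k] equal [1]; the adapted signs agree with the Rademacher functions almost
     surely. *)
  exists (fun=> 1) => k _; apply: filterS (rademacher_sign_ae k) => x ->.
  by rewrite mul1r.
split.
- by move=> d T P D n f adm; exact: exp_square_moment_le.
- by move=> C hC; apply: rademacher_best => n f adm _; exact: hC.
- move=> C hC; apply: rademacher_best => n f adm _; apply: hC => //.
  exact: dyadic_intervals_dyadic.
- exact: rademacher_best.
Qed.
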